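(* Let $(G,\mathcal{E}_G)$ and $(H,\mathcal{E}_H)$ be coarse groups and let $f\colon(G,\mathcal{E}_G)\to(H,\mathcal{E}_H)$ be a quasi-homomorphism which is a coarse equivalence with coarse inverse $g\colon H\to G$. If $\mathcal{E}_H$ is uniformly invariant, then $g$ is a quasi-homomorphism.
   Context: A coarse structure on a set $X$ is a family $\mathcal{E}\subseteq\mathcal{P}(X\times X)$ containing the diagonal, closed under subsets and finite unions, under inverses $E^{-1}=\{(y,x)\mid(x,y)\in E\}$, and under compositions $E\circ F=\{(x,y)\mid\exists z:(x,z)\in E,(z,y)\in F\}$. A (left) coarse group is a pair $(G,\mathcal{E})$ of a group $G$ and a coarse structure $\mathcal{E}$ on $G$ such that $GE:=\{(gx,gy)\mid g\in G,(x,y)\in E\}\in\mathcal{E}$ for every $E\in\mathcal{E}$. The coarse structure $\mathcal{E}$ is uniformly invariant if for every $E\in\mathcal{E}$ one has $E^G:=\{(g^{-1}xg,g^{-1}yg)\mid g\in G,(x,y)\in E\}\in\mathcal{E}$. Maps $f,g\colon S\to(X,\mathcal{E})$ from a set to a coarse space are close, $f\sim g$, if $\{(f(s),g(s))\mid s\in S\}\in\mathcal{E}$. A map $f\colon G\to(H,\mathcal{E}_H)$ from a group to a coarse group is a quasi-homomorphism if the maps $G\times G\to H$, $(x,y)\mapsto f(xy)$ and $(x,y)\mapsto f(x)f(y)$, are close. A map $f\colon(X,\mathcal{E}_X)\to(Y,\mathcal{E}_Y)$ is bornologous if $(f\times f)(E)\in\mathcal{E}_Y$ for all $E\in\mathcal{E}_X$.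 It is a coarse equivalence if it is bornologous and there is a bornologous map $g\colon Y\to X$, called a coarse inverse of $f$, with $g\circ f\sim \mathrm{id}_X$ and $f\circ g\sim \mathrm{id}_Y$. *)

(* Defs.v *)
From mathcomp Require Import all_boot.
From mathcomp Require Import boolp classical_sets.

Set Implicit Arguments.
Unset Strict Implicit.
Unset Printing Implicit Defensive.

Local Open Scope classical_set_scope.
Local Open Scope group_scope.

(* In [classical_sets], [F \; E] is the set of (x, y) such that (x, z) \in E
   and (z, y) \in F for some z, i.e. the composition written E o F in the
   coarse geometry literature. *)
Record is_coarse_structure (X : Type) (CE : set (set (X * X))) : Prop := {
  coarse_diag : CE (range (fun x : X => (x, x)));
  coarse_sub : forall E F : set (X * X), F `<=` E -> CE E -> CE F;
  coarse_union : forall E F : set (X * X), CE E -> CE F -> CE (E `|` F);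
  coarse_inv : forall E : set (X * X), CE E -> CE (E^-1)%relation;
  coarse_comp : forall E F : set (X * X), CE E -> CE F -> CE (F \; E)%relation
}.

Definition left_translates (G : groupType) (E : set (G * G)) : set (G * G) :=
  [set (g * p.1, g * p.2) | g in [set: G] & p in E].

(* [x ^ g] is the conjugate [g^-1 * (x * g)]. *)
Definition conjugates (G : groupType) (E : set (G * G)) : set (G * G) :=
  [set (p.1 ^ g, p.2 ^ g) | g in [set: G] & p in E].

Definition is_coarse_group (G : groupType) (CE : set (set (G * G))) : Prop :=
  is_coarse_structure CE /\ forall E, CE E -> CE (left_translates E).

Definition uniformly_invariant (G : groupType) (CE : set (set (G * G))) : Prop :=
  forall E, CE E -> CE (conjugates E).

Definition close (S X : Type) (CE : set (set (X * X))) (f g : S -> X) : Prop :=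
  CE (range (fun s : S => (f s, g s))).

Definition quasi_homomorphism (G H : groupType) (CEH : set (set (H * H)))
    (f : G -> H) : Prop :=
  close CEH (fun p : G * G => f (p.1 * p.2)) (fun p : G * G => f p.1 * f p.2).

Definition bornologous (X Y : Type) (CEX : set (set (X * X)))
    (CEY : set (set (Y * Y))) (f : X -> Y) : Prop :=
  forall E, CEX E -> CEY [set (f p.1, f p.2) | p in E].

Definition coarse_inverse (X Y : Type) (CEX : set (set (X * X)))
    (CEY : set (set (Y * Y))) (f : X -> Y) (g : Y -> X) : Prop :=
  [/\ bornologous CEY CEX g, close CEX (g \o f) id & close CEY (f \o g) id].

Definition coarse_equivalence (X Y : Type) (CEX : set (set (X * X)))
    (CEY : set (set (Y * Y))) (f : X -> Y) : Prop :=
  bornologous CEX CEY f /\ exists g : Y -> X, coarse_inverse CEX CEY f g.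

(* Main.v *)
Require Import Defs.
From mathcomp Require Import all_boot.
From mathcomp Require Import boolp classical_sets.

(** Closeness of maps is an equivalence relation, stable under reparametrizing
    the source and under composing with a bornologous map.  Uniform invariance
    of the coarse structure of [H] makes it a congruence for multiplication in
    [H]: left multiplication is controlled in every coarse group, and right
    multiplication by [y] is left multiplication by [y] after conjugation by
    [y], since [x * y = y * x ^ y].  So, as functions of [(x, y)],

      f (g x * g y) ~ f (g x) * f (g y) ~ x * y ~ f (g (x * y)),

    the middle step being the congruence property applied to [f \o g ~ id].
    Because [g] is bornologous and [g \o f ~ id], the map [f] reflects
    closeness ([close_reflect]), whence [g x * g y ~ g (x * y)]. *)

Set Implicit Arguments.
Unset Strict Implicit.

Local Open Scope classical_set_scope.
Local Open Scope group_scope.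

Section Closeness.
Variables (X : Type) (CE : set (set (X * X))).
Hypothesis hX : is_coarse_structure CE.

Lemma close_sym (S : Type) (u v : S -> X) : close CE u v -> close CE v u.
Proof.
move=> /(coarse_inv hX); apply: (coarse_sub hX).
by move=> _ [s _ <-]; exists s.
Qed.

Lemma close_trans (S : Type) (v u w : S -> X) :
  close CE u v -> close CE v w -> close CE u w.
Proof.
move=> huv hvw; apply: (coarse_sub hX) (coarse_comp hX huv hvw).
by move=> _ [s _ <-]; exists (v s); exists s.
Qed.

Lemma close_precomp (S T : Type) (k : T -> S) (u v : S -> X) :
  close CE u v -> close CE (u \o k) (v \o k).
Proof.
by apply: (coarse_sub hX) => _ [t _ <-]; exists (k t).
Qed.

End Closeness.

Lemma close_postcomp (S X Y : Type) (CEX : set (set (X * X)))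
    (CEY : set (set (Y * Y))) (h : X -> Y) (u v : S -> X) :
  is_coarse_structure CEY -> bornologous CEX CEY h ->
  close CEX u v -> close CEY (h \o u) (h \o v).
Proof.
move=> hY hh /hh; apply: (coarse_sub hY) => _ [s _ <-].
by exists (u s, v s) => //; exists s.
Qed.

(** From [f \o u ~ f \o v], applying [g] and using [g \o f ~ id] at both ends
    recovers [u ~ v]: coarse equivalences are injective up to closeness. *)
Lemma close_reflect (S X Y : Type) (CEX : set (set (X * X)))
    (CEY : set (set (Y * Y))) (f : X -> Y) (g : Y -> X) (u v : S -> X) :
  is_coarse_structure CEX -> bornologous CEY CEX g -> close CEX (g \o f) id ->
  close CEY (f \o u) (f \o v) -> close CEX u v.
Proof.
move=> hX hg hgf /(close_postcomp hX hg) hfuv.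
have huv (w : S -> X) : close CEX (g \o (f \o w)) w := close_precomp hX w hgf.
exact: (close_trans hX (close_sym hX (huv u)) (close_trans hX hfuv (huv v))).
Qed.

Section Multiplication.
Variables (S : Type) (H : groupType) (CE : set (set (H * H))).
Hypothesis hH : is_coarse_group CE.

Lemma close_mull (w u v : S -> H) :
  close CE u v -> close CE (fun s => w s * u s) (fun s => w s * v s).
Proof.
case: hH => hC hleft /hleft; apply: (coarse_sub hC) => _ [s _ <-].
by exists (w s) => //; exists (u s, v s) => //; exists s.
Qed.

(** Conjugating by [w s] turns multiplication by [w s] on the right into
    multiplication on the left; this is where uniform invariance enters. *)
Lemma close_mulr (w u v : S -> H) : uniformly_invariant CE ->
  close CE u v -> close CE (fun s => u s * w s) (fun s => v s * w s).
Proof.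
case: (hH) => hC _ hinv huv.
have hconj : close CE (fun s => u s ^ w s) (fun s => v s ^ w s).
  apply: (coarse_sub hC) (hinv _ huv) => _ [s _ <-].
  by exists (w s) => //; exists (u s, v s) => //; exists s.
have := close_mull w hconj.
by under [X in close _ X _]eq_fun do rewrite -conjgC;
   under [X in close _ _ X]eq_fun do rewrite -conjgC.
Qed.

Lemma close_mul (u u' v v' : S -> H) : uniformly_invariant CE ->
  close CE u u' -> close CE v v' ->
  close CE (fun s => u s * v s) (fun s => u' s * v' s).
Proof.
move=> hinv hu hv; apply: (close_trans hH.1 _ (close_mulr v' hinv hu)).
exact: close_mull.
Qed.

End Multiplication.

Theorem theorem4p11 (G H : groupType)
    (CEG : set (set (G * G))) (CEH : set (set (H * H)))
    (f : G -> H) (g : H -> G)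
    (hG : is_coarse_group CEG) (hH : is_coarse_group CEH)
    (hfq : quasi_homomorphism CEH f)
    (hfe : coarse_equivalence CEG CEH f)
    (hg : coarse_inverse CEG CEH f g)
    (hinv : uniformly_invariant CEH) :
  quasi_homomorphism CEG g.
Proof.
case: hg => hgb hgf hfg.
have fg_close (S : Type) (k : S -> H) : close CEH (f \o g \o k) k :=
  close_precomp hH.1 k hfg.
apply: (close_reflect hG.1 hgb hgf).
apply: (close_trans hH.1 (fg_close _ (fun p : H * H => p.1 * p.2))).
apply: (close_sym hH.1).
apply: (close_trans hH.1
  (close_precomp hH.1 (fun p : H * H => (g p.1, g p.2)) hfq)).
exact: (close_mul hH hinv (fg_close _ fst) (fg_close _ snd)).
Qed.
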